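(* For every positive integer $n$, $$\mathrm{dis}(n) \geq (n+1)^{\frac{n-1}{2}},$$ where $\mathrm{dis}(n)$ is the minimal number of simplices in a dissection of the $n$-dimensional cube $[0,1]^n$ into $n$-dimensional simplices all of whose vertices are vertices of the cube.
   Context: A dissection of an $n$-dimensional convex polytope $P$ is a representation of $P$ as a union of finitely many non-overlapping (i.e. with pairwise disjoint interiors) non-degenerate $n$-dimensional simplices, each of whose vertices are vertices of $P$ (no additional vertices are allowed). The simplices are not required to intersect in common faces. $\mathrm{dis}(n)$ denotes the minimal number of simplices in a dissection of the $n$-dimensional cube. *)

(* Defs.v *)
From HB Require Import structures.
From mathcomp Require Import all_boot all_order all_algebra perm.
From mathcomp Require Import all_classical all_reals all_analysis.

Set Implicit Arguments.
Unset Strict Implicit.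
Unset Printing Implicit Defensive.

Import Order.TTheory GRing.Theory Num.Theory.
Import numFieldNormedType.Exports.

Local Open Scope classical_set_scope.
Local Open Scope ring_scope.

Definition convex_hull (R : realType) (n k : nat)
    (v : 'I_k -> 'rV[R]_n) : set 'rV[R]_n :=
  [set x | exists w : 'I_k -> R,
    [/\ forall i, 0 <= w i, \sum_i w i = 1 & x = \sum_i w i *: v i]].

Definition affinely_independent (R : realType) (n k : nat)
    (v : 'I_k -> 'rV[R]_n) : Prop :=
  forall w : 'I_k -> R,
    \sum_i w i = 0 -> \sum_i w i *: v i = 0 -> forall i, w i = 0.

(* The vertices of a convex polytope are its extreme points. *)
Definition vertices (R : realType) (n : nat)
    (P : set 'rV[R]_n) : set 'rV[R]_n :=
  [set x | P x /\ forall (y z : 'rV[R]_n) (t : R), P y -> P z -> 0 < t < 1 ->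
    x = t *: y + (1 - t) *: z -> y = z].

(* The simplex of index a is the convex hull of its n + 1 vertices S a.       *)
(* Simplices with distinct indices are automatically distinct as sets, since  *)
(* their interiors are nonempty and disjoint, so N counts the simplices.      *)
Definition is_dissection (R : realType) (n : nat) (P : set 'rV[R]_n)
    (N : nat) (S : 'I_N -> 'I_n.+1 -> 'rV[R]_n) : Prop :=
  [/\ forall a i, vertices P (S a i),
      forall a, affinely_independent (S a),
      P = \bigcup_(a in [set: 'I_N]) convex_hull (S a)
    & forall a b, a != b ->
        interior (convex_hull (S a)) `&` interior (convex_hull (S b)) = set0].

Definition has_dissection (R : realType) (n : nat) (P : set 'rV[R]_n)
    (N : nat) : Prop :=
  exists S : 'I_N -> 'I_n.+1 -> 'rV[R]_n, is_dissection P S.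

Definition cube (R : realType) (n : nat) : set 'rV[R]_n :=
  [set x | forall i, 0 <= x ord0 i <= 1].

(* Existence of a dissection of the cube, needed for the minimum to make      *)
(* sense: the simplices {x | x_(t 0) >= ... >= x_(t (n-1))} for the orderings *)
(* t of the coordinates. Here s j is the rank of the coordinate j.            *)
Section cube_has_dissection.
Variables (R : realType) (n : nat).

Definition kuhn (s : {perm 'I_n}) (k : 'I_n.+1) : 'rV[R]_n := \row_j (s j < k)%N%:R.

Lemma kuhn_sumE (s : {perm 'I_n}) (w : 'I_n.+1 -> R) j :
  (\sum_k w k *: kuhn s k) ord0 j = \sum_(k < n.+1 | (s j < k)%N) w k.
Proof.
rewrite summxE [RHS]big_mkcond /=; apply: eq_bigr => k _.
by rewrite !mxE; case: ifP => _; rewrite ?mulr1 ?mulr0.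
Qed.

Lemma kuhn_vertex s k : vertices (@cube R n) (kuhn s k).
Proof.
split=> [j|y z t Cy Cz /andP[t0 t1] e].
  by rewrite mxE; case: (_ < _)%N; rewrite ?lexx ler01.
apply/rowP => j; have /rowP/(_ j) := e; rewrite !mxE.
move: (Cy j) (Cz j) => /andP[y0 y1] /andP[z0 z1].
have t1' : 0 < 1 - t by rewrite subr_gt0.
case: (_ < _)%N => /= ej; last first.
  have : t * y ord0 j + (1 - t) * z ord0 j = 0 by rewrite -ej.
  move/eqP; rewrite paddr_eq0 ?mulr_ge0 ?(ltW t0) ?(ltW t1')//.
  rewrite !mulf_eq0 (gt_eqF t0) (gt_eqF t1') /=.
  by move=> /andP[/eqP-> /eqP->].
have : t * (1 - y ord0 j) + (1 - t) * (1 - z ord0 j) = 0.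
  rewrite !mulrBr !mulr1 addrACA -opprD -ej.
  by rewrite addrCA subrr addr0 subrr.
move/eqP; rewrite paddr_eq0 ?mulr_ge0 ?(ltW t0) ?(ltW t1') ?subr_ge0//.
rewrite !mulf_eq0 (gt_eqF t0) (gt_eqF t1') /= !subr_eq0.
by move=> /andP[/eqP<- /eqP<-].
Qed.

Lemma kuhn_free s : affinely_independent (kuhn s).
Proof.
move=> w w0 wv k.
have G m : \sum_(i < n.+1 | (m <= i)%N) w i = 0.
  case: m => [|m]; first by rewrite -[RHS]w0; exact: eq_bigl.
  have [mn|nm] := ltnP m n; last first.
    by rewrite big_pred0 // => i; apply/negbTE; rewrite -leqNgt (leq_trans _ nm)// -ltnS.
  by have /rowP/(_ (s^-1%g (Ordinal mn))) := wv; rewrite kuhn_sumE permKV mxE.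
have := G k; rewrite (bigD1 k)//= (_ : \sum_(i < n.+1 | _) _ = 0) ?addr0//.
rewrite -[RHS](G k.+1); apply: eq_bigl => i.
by rewrite ltn_neqAle eq_sym andbC.
Qed.

Lemma kuhn_hull_cube s : convex_hull (kuhn s) `<=` @cube R n.
Proof.
move=> x [w [w0 w1 ->]] j; rewrite kuhn_sumE sumr_ge0//= -w1.
by rewrite [leRHS](bigID (fun k : 'I_n.+1 => (s j < k)%N))/= lerDl sumr_ge0.
Qed.

Lemma kuhn_le (s : {perm 'I_n}) i j x : (s i < s j)%N -> convex_hull (kuhn s) x ->
  x ord0 j <= x ord0 i.
Proof.
move=> sij [w [w0 w1 ->]]; rewrite !kuhn_sumE.
rewrite [leRHS](bigID (fun k : 'I_n.+1 => (s j < k)%N))/=.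
rewrite [X in _ <= X + _](eq_bigl (fun k : 'I_n.+1 => (s j < k)%N)).
  by rewrite lerDl sumr_ge0.
by move=> k /=; rewrite andb_idl// => /(ltn_trans sij).
Qed.

Lemma kuhn_cover x : cube x -> exists s, convex_hull (kuhn s) x.
Proof.
move=> Cx; pose t := sort (fun i j => x ord0 j <= x ord0 i) (enum 'I_n).
have tu : uniq t by rewrite sort_uniq enum_uniq.
have tE i : i \in t by rewrite mem_sort mem_enum.
have szt : size t = n by rewrite size_sort size_enum_ord.
have idx i : (index i t < n)%N by rewrite -[ltnRHS]szt index_mem.
have sinj : injective (fun i => Ordinal (idx i)).
  move=> i j [] /(congr1 (nth i t)); rewrite !nth_index//.
exists (perm sinj); pose y := nth 0 (1 :: [seq x ord0 i | i <- t]).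
have ydec k : y k.+1 <= y k.
  have [kn|nk] := ltnP k n; last first.
    have -> : y k.+1 = 0 by rewrite /y nth_default//= size_map szt.
    rewrite /y; case: k nk => [|k] nk /=; first exact: ler01.
    have [kn|nk'] := ltnP k n; last by rewrite nth_default ?size_map ?szt.
    have i0 : 'I_n := Ordinal kn.
    by rewrite (nth_map i0) ?szt//; have /andP[] := Cx (nth i0 t k).
  have i0 : 'I_n := Ordinal kn.
  rewrite /y/= (nth_map i0) ?szt//; case: k kn => [|k] kn /=.
    by have /andP[] := Cx (nth i0 t 0).
  rewrite (nth_map i0) ?szt ?(ltnW kn)//.
  have : sorted (fun i j => x ord0 j <= x ord0 i) t.
    by apply: sort_sorted => i j; exact: le_total.
  by move/(sortedP i0) => /(_ k); rewrite szt; exact.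
have tel r : (r <= n.+1)%N ->
    \sum_(k < n.+1 | (r <= k)%N) (y k - y k.+1) = y r.
  elim: r => [|r IH] rn.
    rewrite (eq_bigl xpredT)// -(big_mkord xpredT (fun k => y k - y k.+1)).
    rewrite (telescope_sumr_eq (fun k => - y k))// => [|k _].
      by rewrite opprK {1}/y nth_default ?oppr0 ?add0r//= size_map szt.
    by rewrite opprK addrC.
  have := IH (ltnW rn); rewrite (bigD1 (Ordinal rn))//= => e.
  apply: (addrI (y r - y r.+1)); rewrite subrK -[RHS]e; congr (_ + _).
  by apply: eq_bigl => i; rewrite ltn_neqAle eq_sym andbC.
exists (fun k => y k - y k.+1); split=> [k||].
- by rewrite subr_ge0.
- by rewrite -[RHS](tel 0%N isT); apply: eq_bigl.
- apply/rowP => j; rewrite kuhn_sumE permE/= tel ?ltnS ?(ltnW (idx j))//.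
  by rewrite /y/= (nth_map j) ?szt// nth_index.
Qed.

Lemma card_rank_lt (s : {perm 'I_n}) j : #|[set i | (s i < s j)%N]%SET| = s j.
Proof.
have -> : [set i | (s i < s j)%N]%SET = (s @^-1: [set k : 'I_n | (k < s j)%N])%SET.
  by apply/setP => i; rewrite !inE.
rewrite card_preimset; last exact: perm_inj.
rewrite -sum1_card (eq_bigl (fun k : 'I_n => (k < s j)%N)); last first.
  by move=> k; rewrite inE.
by rewrite -(big_ord_widen n (fun=> 1%N)) ?sum1_card ?card_ord// ltnW.
Qed.

Lemma exists_inversion (s t : {perm 'I_n}) : s != t ->
  exists i j, (s i < s j)%N /\ (t j < t i)%N.
Proof.
move=> st; apply: contrapT => H.
have st_lt i j : (s i < s j)%N -> (t i < t j)%N.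
  move=> sij; rewrite ltnNge leq_eqVlt; apply/negP => /orP[/eqP/val_inj/perm_inj ji|tji].
    by rewrite ji ltnn in sij.
  by apply: H; exists i, j.
move/eqP : st; apply; apply/permP => j; apply/val_inj.
rewrite /= -(card_rank_lt s) -(card_rank_lt t); congr #|pred_of_set _|.
apply/setP => i; rewrite !inE; apply/idP/idP; first exact: st_lt.
move=> tij; rewrite ltnNge leq_eqVlt; apply/negP => /orP[/eqP/val_inj/perm_inj ji|/st_lt].
  by rewrite ji ltnn in tij.
by rewrite ltnNge (ltnW tij).
Qed.

Lemma kuhn_disjoint (s t : {perm 'I_n}) : s != t ->
  interior (convex_hull (kuhn s)) `&` interior (convex_hull (kuhn t)) = set0.
Proof.
move=> /exists_inversion[i [j [sij tji]]].
rewrite -subset0 -interiorI => p /nbhs_ballP[e /= e0 pe].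
have ij : i != j by apply: contraTneq sij => ->; rewrite ltnn.
have coord q : ball p e q -> q ord0 i = q ord0 j.
  move=> /pe[/(kuhn_le sij) h1 /(kuhn_le tji) h2].
  by apply/eqP; rewrite eq_le h1 h2.
pose q := p + (e / 2) *: delta_mx ord0 i.
have /coord : ball p e q.
  split=> // a b; rewrite ord1 !mxE /ball/= opprD addNKr normrN normrM.
  rewrite gtr0_norm ?divr_gt0//.
  rewrite (le_lt_trans (y := e / 2 * 1))//.
    by rewrite ler_wpM2l ?divr_ge0 ?(ltW e0)//; case: (b == i); rewrite ?normr1 ?normr0.
  by rewrite mulr1 ltr_pdivrMr// ltr_pMr// ltr1n.
rewrite !mxE !eqxx (eq_sym j) (negbTE ij)/= mulr1 mulr0 addr0 (coord p); last exact: ballxx.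
by move/eqP; rewrite -subr_eq0 addrAC subrr add0r gt_eqF// divr_gt0.
Qed.

Lemma cube_has_dissection : exists N, `[< has_dissection (@cube R n) N >].
Proof.
exists #|{perm 'I_n}|; apply/asboolP; exists (fun a => kuhn (enum_val a)); split.
- by move=> a i; exact: kuhn_vertex.
- by move=> a; exact: kuhn_free.
- apply/seteqP; split=> x; last by move=> [a _]; exact: kuhn_hull_cube.
  by move=> /kuhn_cover[s xs]; exists (enum_rank s) => //; rewrite enum_rankK.
- by move=> a b ab; apply: kuhn_disjoint; apply: contra ab => /eqP/enum_val_inj ->.
Qed.

End cube_has_dissection.

Definition dis (R : realType) (n : nat) : nat :=
  ex_minn (cube_has_dissection R n).

(* Main.v *)
Require Import Defs.
From mathcomp Require Import all_boot all_order all_algebra.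
From mathcomp Require Import all_classical all_reals all_analysis.
From mathcomp Require Import zify ring lra.

(* Prepend a coordinate 1 to the vertices of each simplex q to get a 0/1      *)
(* matrix M_q of size n + 1, and let k_i(q) be the number of ones in its      *)
(* column i.                                                                  *)
(*   Hadamard's inequality, applied after centring the columns, gives         *)
(*     |det M_q|^2 (n + 1)^(n - 1) <= prod_i k_i(q) (n + 1 - k_i(q)).         *)
(*   The i-th coordinate of a uniform point of the simplex q has the density  *)
(* of Beta(k_i(q), n + 1 - k_i(q)), and these densities average to the        *)
(* uniform one over a dissection of the cube. As Bernstein polynomials of     *)
(* degree n - 1 are linearly independent, the simplices with k_i(q) = k have  *)
(* total volume 1/n for each k = 1, ..., n. Volumes are replaced by counts of *)
(* lattice points in the cones over the simplices: the role of n! vol(q) is   *)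
(* played by the number of lattice points of the half-open parallelepiped     *)
(* spanned by the rows of M_q.                                                *)
(*   Hence the volume-weighted geometric mean of prod_i k_i (n + 1 - k_i) is  *)
(* n!^2, and AM-GM bounds the number of simplices from below.                 *)

Set Implicit Arguments.
Unset Strict Implicit.
Unset Printing Implicit Defensive.

Import Order.TTheory GRing.Theory Num.Theory.
Import numFieldNormedType.Exports.

Local Open Scope ring_scope.

(** A 0/1 simplex has large volume only if its columns are balanced between zeros and ones, whereas
    a dissection of the cube must use all balances equally, by volume. The first fact is
    [bit_mx_hadamard], passed on to lattice points by [card_cell_le_det]. For the second, fix a
    coordinate [i] and count the lattice points of the cone over the cube at height [s + t] whose
    [i]-th coordinate is [s]. Each is a cell point of some simplex plus a nonnegative integer
    combination of its vertices ([grid_upper]), and the combinations with all coefficients at least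
    1 give distinct points ([grid_lower]). The two bounds have the same leading term, so rescaling
    gives [weight_eq], sum_q w_q p^(k_q - 1) = (p + 1)^(n - 1). Comparing coefficients in [p] gives
    [sum_card_cell_ones]. [dissection_lattice] extracts the combinatorial data from a dissection,
    and [lattice_dissection_card] combines the two facts. *)

(** * Gram determinants and Hadamard's inequality *)

Lemma mulmx_tr_diag (F : pzRingType) m n (A : 'M[F]_(m, n)) i :
  (A *m A^T) i i = \sum_j A i j ^+ 2.
Proof. by rewrite mxE; apply: eq_bigr => j _; rewrite mxE expr2. Qed.

Lemma mulmx_tr_eq0 (F : realDomainType) n (u : 'rV[F]_n) :
  u *m u^T = 0 -> u = 0.
Proof.
move=> /matrixP/(_ 0 0); rewrite mulmx_tr_diag mxE => /eqP.
rewrite psumr_eq0 => [/allP u0|j _]; last exact: sqr_ge0.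
apply/rowP => j; rewrite mxE; apply/eqP.
by have := u0 j (mem_index_enum j); rewrite sqrf_eq0.
Qed.

(** Gram-Schmidt, by induction on the rows: replacing the first row by its component orthogonal to
    the others keeps the determinant and can only shorten the row. The lower bound 0 lets the
    induction multiply upper bounds. *)
Lemma gram_det_bounds (F : realFieldType) m n (A : 'M[F]_(m, n)) :
  0 <= \det (A *m A^T) <= \prod_i \sum_j A i j ^+ 2.
Proof.
elim: m A => [|m IHm] A; first by rewrite det_mx00 big_ord0 ler01 lexx.
have sum_ge0 i : 0 <= \sum_j A i j ^+ 2 by apply: sumr_ge0 => j _; exact: sqr_ge0.
pose B := @dsubmx F 1 m n A; pose a := @usubmx F 1 m n A; pose G := B *m B^T.
have eA : A = col_mx a B by rewrite (@vsubmxK F 1 m n A).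
have [G0|Gu] := eqVneq (\det G) 0.
  suff -> : \det (A *m A^T) = 0 by rewrite lexx prodr_ge0.
  have /eqP/det0P[u u_neq0 uG] := G0.
  have uB : u *m B = 0.
    by apply: mulmx_tr_eq0; rewrite trmx_mul mulmxA -(mulmxA u) uG mul0mx.
  apply/eqP/det0P; exists (row_mx 0 u : 'rV_(1 + m)).
    apply: contra_neq u_neq0 => /(congr1 (@rsubmx F 1 1 m)).
    by rewrite row_mxKr => ->; apply/rowP => j; rewrite !mxE.
  have uA : row_mx 0 u *m col_mx a B = 0 by rewrite mul_row_col mul0mx uB addr0.
  by rewrite mulmxA [X in _ *m X *m _]eA uA mul0mx.
have Gunit : G \in unitmx by rewrite unitmxE unitfE.
(* [c *m B] is the orthogonal projection of [a] onto the row space of [B]. *)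
pose c := a *m B^T *m invmx G; pose a' : 'rV[F]_n := a - c *m B.
have a'B : a' *m B^T = 0 by rewrite mulmxBl -mulmxA mulmxKV// subrr.
have norm_a : a *m a^T = a' *m a'^T + (c *m B) *m (c *m B)^T.
  have -> : a = a' + c *m B by rewrite subrK.
  rewrite [in LHS]linearD /= mulmxDl !mulmxDr !trmx_mul (mulmxA a') a'B mul0mx addr0.
  have -> : c *m B *m a'^T = (a' *m B^T *m c^T)^T by rewrite !trmx_mul !trmxK mulmxA.
  by rewrite a'B mul0mx trmx0 add0r.
pose L : 'M[F]_(1 + m) := block_mx 1%:M (- c) 0 1%:M.
have detL : \det L = 1 by rewrite det_ublock !det1 mulr1.
have LA : L *m col_mx a B = col_mx a' B.
  by rewrite mul_block_col mul1mx mulNmx mul0mx mul1mx add0r.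
have detE : \det (A *m A^T) = (\sum_j a' 0 j ^+ 2) * \det G.
  transitivity (\det (L *m (A *m A^T) *m L^T)).
    by rewrite !det_mulmx det_tr detL mul1r mulr1.
  have -> : L *m (A *m A^T) *m L^T = col_mx a' B *m (col_mx a' B)^T.
    by rewrite -LA trmx_mul -eA !mulmxA.
  rewrite tr_col_mx mul_col_row a'B.
  have -> : B *m a'^T = 0 by apply: trmx_inj; rewrite trmx_mul trmxK a'B trmx0.
  by rewrite (@det_ublock _ 1 m) det_mx11 mulmx_tr_diag.
have /andP[detG0 detG_le] := IHm B.
have a'0 : 0 <= \sum_j a' 0 j ^+ 2 by apply: sumr_ge0 => j _; exact: sqr_ge0.
rewrite detE mulr_ge0//= big_ord_recl; apply: ler_pM => //.
- have := congr1 (fun X : 'M[F]_1 => X 0 0) norm_a.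
  rewrite [X in _ = X -> _]mxE !mulmx_tr_diag.
  have -> : \sum_j A ord0 j ^+ 2 = \sum_j a 0 j ^+ 2.
    by apply: eq_bigr => j _; rewrite mxE; congr (A _ _ ^+ 2); exact: val_inj.
  move=> ->.
  by rewrite lerDl; apply: sumr_ge0 => j _; exact: sqr_ge0.
- apply: le_trans detG_le _; rewrite le_eqVlt; apply/orP; left; apply/eqP.
  apply: eq_bigr => i _; apply: eq_bigr => j _; rewrite mxE.
  by congr (A _ _ ^+ 2); exact: val_inj.
Qed.

Lemma hadamard (F : realFieldType) n (A : 'M[F]_n) :
  \det A ^+ 2 <= \prod_i \sum_j A i j ^+ 2.
Proof.
by have /andP[_] := gram_det_bounds A; rewrite det_mulmx det_tr -expr2.
Qed.

(** * Lattice classes modulo an integer matrix *)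

Lemma card_ord_lt m K : (m <= K)%N -> #|[pred x : 'I_K | (x < m)%N]| = m.
Proof.
move=> mK; rewrite -sum1_card (eq_bigl (fun x : 'I_K => (x < m)%N)) //.
by rewrite -(big_ord_widen K (fun=> 1%N)) // sum1_card card_ord.
Qed.

Lemma card_familyE (aT rT : finType) (P : aT -> pred rT) :
  #|(family P : simpl_pred {ffun aT -> rT})| = (\prod_i #|P i|)%N.
Proof. by rewrite card_family foldrE big_map big_enum. Qed.

(* The Smith normal form identifies Z^d / Z^d A with a product of cyclic      *)
(* groups whose orders multiply to |det A|.                                   *)
Lemma card_le_lattice_index (I : finType) d (A : 'M[int]_d) (X : {set I})
    (f : I -> 'rV[int]_d) :
  \det A != 0 ->
  {in X &, forall x y, (exists z, f x - f y = z *m A) -> x = y} ->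
  (#|X| <= `|\det A|)%N.
Proof.
move=> detA f_inj; have [L Lu [R Ru [s _ AE]]] := int_Smith_normal_form A.
pose e (i : 'I_d) : int := s`_i; pose D : 'M[int]_d := diag_mx (\row_i e i).
have {}AE : A = L *m D *m R.
  rewrite AE; congr (_ *m _ *m _); apply/matrixP => i j; rewrite !mxE.
  by case: eqP => [/val_inj->|/eqP/negPf ij]; rewrite ?eqxx // -val_eqE ij.
have absdet1 (P : 'M[int]_d) : P \in unitmx -> `|\det P|%N = 1%N.
  move=> /mulmxV/(congr1 determinant); rewrite det_mulmx det1 => /(congr1 absz).
  by rewrite abszM => /eqP; rewrite muln_eq1 => /andP[/eqP].
have detE : `|\det A|%N = (\prod_(i < d) `|e i|)%N.
  rewrite AE !det_mulmx det_diag !abszM !absdet1 // mul1n muln1.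
  elim/big_ind2: _ => // [_ x _ y <- <-|i _]; first by rewrite abszM.
  by rewrite mxE.
have s_neq0 (i : 'I_d) : e i != 0.
  apply: contraTneq (isT : true) => si0; move: detA.
  by rewrite -absz_eq0 detE (bigD1 i) //= si0 mul0n.
(* As [L] is unimodular, [f x] and [f y] agree modulo the row lattice of [A] as soon as [c x i] and
   [c y i] agree modulo every [e i]. So [g] records these residues, and [K] only provides a common
   finite type for them. *)
pose c x (i : 'I_d) : int := (f x *m invmx R) 0 i.
pose K := (\max_(i < d) `|e i|)%N.
pose g x : {ffun 'I_d -> 'I_K.+1} :=
  [ffun i => inord `|(c x i %% e i)%Z|].
have mod_lt x (i : 'I_d) : (`|(c x i %% e i)%Z| < `|e i|)%N.
  by rewrite -ltz_nat gez0_abs ?modz_ge0 // abszE ltz_mod.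
have leK (i : 'I_d) : (`|e i| <= K)%N by exact: (leq_bigmax i).
have gE x i : g x i = `|(c x i %% e i)%Z|%N :> nat.
  by rewrite ffunE inordK // ltnS (leq_trans (ltnW (mod_lt _ _))).
have g_inj : {in X &, injective g}.
  move=> x y xX yX gxy; apply: f_inj => //.
  pose q := \row_i ((c x i %/ e i)%Z - (c y i %/ e i)%Z).
  exists (q *m invmx L).
  rewrite {1}AE -!mulmxA mulKmx // mulmxA.
  have -> : q *m D = (f x - f y) *m invmx R.
    apply/rowP => i; rewrite mul_mx_diag mulmxBl [RHS]mxE [X in _ = _ + X]mxE [LHS]mxE
      [q 0 i]mxE [X in _ * X]mxE -/(c x i) -/(c y i).
    have /(congr1 (fun h : {ffun 'I_d -> 'I_K.+1} => Posz (h i))) := gxy.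
    rewrite !gE !gez0_abs ?modz_ge0 // => exy.
    have := divz_eq (c x i) (e i).
    have := divz_eq (c y i) (e i).
    rewrite exy; move: (c x i %/ e i)%Z (c y i %/ e i)%Z (c y i %% e i)%Z.
    by move=> u v w -> ->; ring.
  by rewrite mulmxKV.
rewrite detE -(card_in_imset g_inj).
pose P (i : 'I_d) := [pred x : 'I_K.+1 | (x < `|e i|)%N].
have -> : (\prod_(i < d) `|e i|)%N = (\prod_i #|P i|)%N.
  by apply: eq_bigr => i _; rewrite card_ord_lt // ltnW // ltnS.
rewrite -card_familyE; apply/subset_leq_card/fintype.subsetP => _ /imsetP[x _ ->].
by apply/familyP => i; rewrite inE gE mod_lt.
Qed.

(** * 0/1 matrices and their parallelepipeds *)

Definition bit_mx (F : pzSemiRingType) d (b : 'I_d -> 'I_d -> bool) : 'M[F]_d :=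
  \matrix_(j, l) (b j l)%:R.

Definition nat_row (F : pzSemiRingType) d (x : 'I_d -> nat) : 'rV[F]_d :=
  \row_l (x l)%:R.

(* The lattice points of the half-open parallelepiped spanned by the rows of  *)
(* [bit_mx F b]; each of their coordinates is a sum of [d] numbers in [0, 1). *)
Definition cell (F : realFieldType) d (b : 'I_d -> 'I_d -> bool) :
    {set {ffun 'I_d -> 'I_d}} :=
  [set r : {ffun 'I_d -> 'I_d} |
    [forall j, 0 <= (nat_row F (fun l => r l) *m invmx (bit_mx F b)) 0 j < 1]].

Definition ones d (b : 'I_d -> 'I_d -> bool) l : nat := #|[set j | b j l]|.

Lemma bit_mx_map (F : pzRingType) d (b : 'I_d -> 'I_d -> bool) :
  bit_mx F b = map_mx intr (bit_mx int b).
Proof. by apply/matrixP => i j; rewrite !mxE; case: (b i j). Qed.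

Lemma sum_ones (F : pzSemiRingType) d (b : 'I_d -> 'I_d -> bool) l :
  \sum_j (b j l)%:R = (ones b l)%:R :> F.
Proof.
rewrite -natr_sum /ones -sum1dep_card [in RHS]big_mkcond;
congr _%:R; apply: eq_bigr => j _; case: (b j l).
Qed.

(** Two cell points congruent modulo the row lattice differ by integer coefficients strictly between
    -1 and 1, hence coincide: cell points represent distinct classes. *)
Lemma card_cell_le_det (F : realFieldType) d (b : 'I_d -> 'I_d -> bool) :
  \det (bit_mx F b) != 0 -> #|cell F b|%:R <= `|\det (bit_mx F b)|.
Proof.
set M := bit_mx F b => detM.
have detE : \det M = (\det (bit_mx int b))%:~R.
  by rewrite /M bit_mx_map -det_map_mx.
have detZ : \det (bit_mx int b) != 0.
  by apply: contraNneq detM; rewrite detE => ->.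
rewrite detE -intr_norm -abszE pmulrn ler_int lez_nat.
apply: (card_le_lattice_index
  (f := fun r : {ffun 'I_d -> 'I_d} => nat_row int (fun l => r l))) => //.
move=> r r'; rewrite !inE => /forallP cr /forallP cr' [z zE].
have Mu : M \in unitmx by rewrite unitmxE unitfE.
have zE' : map_mx intr z =
    nat_row F (fun l => r l) *m invmx M - nat_row F (fun l => r' l) *m invmx M.
  rewrite -mulmxBl; apply: (canRL (mulmxK Mu)).
  rewrite /M bit_mx_map -map_mxM -zE.
  by apply/rowP => l; rewrite !mxE rmorphB !rmorph_nat.
have z0 : z = 0.
  apply/rowP => j; have := congr1 (fun v : 'rV[F]_d => v 0 j) zE'.
  rewrite [X in X = _]mxE [X in _ = X]mxE [X in _ + X]mxE.
  move: (cr j) (cr' j); rewrite -/M.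
  move: (_ 0 j) (_ 0 j) => u v /andP[u0 u1] /andP[v0 v1] zj.
  have z1 : (z 0 j)%:~R < (1 : int)%:~R :> F by rewrite zj; lra.
  have z2 : (-1 : int)%:~R < (z 0 j)%:~R :> F by rewrite zj; lra.
  by move: z1 z2; rewrite !ltr_int mxE; lia.
apply/ffunP => l; apply: val_inj.
move: zE; rewrite z0 mul0mx => /eqP; rewrite subr_eq0 => /eqP/rowP/(_ l).
by rewrite !mxE => /eqP; rewrite !natz => /eqP [].
Qed.

Lemma bit_mx_hadamard (F : realFieldType) n (b : 'I_n.+1 -> 'I_n.+1 -> bool) :
  (forall j, b j ord0) ->
  \det (bit_mx F b) ^+ 2 * n.+1%:R ^+ n <=
  n.+1%:R * \prod_(i < n) ((ones b (lift ord0 i))%:R *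
                           (n.+1%:R - (ones b (lift ord0 i))%:R)).
Proof.
move=> b0; set k := fun i : 'I_n => (ones b (lift ord0 i))%:R : F.
(* Centring with denominators cleared: [C] keeps the column of ones and turns column i into (n + 1)
   times itself minus k_i, of squared norm (n + 1) k_i (n + 1 - k_i). *)
pose C : 'M[F]_(n.+1) := \matrix_(i, l)
  if unlift ord0 i is Some i' then n.+1%:R *+ (l == i) - k i' *+ (l == ord0)
  else (l == ord0)%:R.
have detC : \det C = n.+1%:R ^+ n.
  rewrite det_trig; last first.
    apply/is_trig_mxP => i j ij; rewrite mxE; case: unliftP => [i' ii'|i0].
      have j0 : (j == ord0) = false by apply/negbTE; rewrite -val_eqE /= -lt0n; lia.
      by rewrite j0 -val_eqE /= gtn_eqF // subr0.
    have j0 : (j == ord0) = false by apply/negbTE; rewrite -val_eqE /= -lt0n; lia.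
    by rewrite j0.
  rewrite big_ord_recl mxE unlift_none eqxx mul1r.
  rewrite (eq_bigr (fun=> n.+1%:R)) ?prodr_const ?card_ord // => i _.
  by rewrite mxE liftK eqxx /= subr0.
pose A := C *m (bit_mx F b)^T.
have A0 j : A ord0 j = 1.
  rewrite mxE (bigD1 ord0) //= big1 => [|l /negbTE l0].
    by rewrite !mxE unlift_none eqxx b0 mulr1 addr0.
  by rewrite !mxE unlift_none l0 mul0r.
have Ai i j : A (lift ord0 i) j = n.+1%:R * (b j (lift ord0 i))%:R - k i.
  rewrite mxE (bigD1 ord0) //= (bigD1 (lift ord0 i)) //= big1.
    by rewrite !mxE !liftK eqxx b0 (eqxx (lift _ _)) /= addr0; ring.
  move=> l /andP[/negbTE l0 /negbTE li]; rewrite !mxE liftK l0 li /=.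
  by rewrite subrr mul0r.
have := hadamard A; rewrite det_mulmx det_tr detC exprMn big_ord_recl.
have -> : \sum_j A ord0 j ^+ 2 = n.+1%:R.
  by under eq_bigr do rewrite A0 expr1n; rewrite sumr_const card_ord.
have -> : \prod_(i < n) (\sum_j A (lift ord0 i) j ^+ 2) =
          n.+1%:R ^+ n * \prod_(i < n) (k i * (n.+1%:R - k i)).
  have -> : n.+1%:R ^+ n = \prod_(i < n) n.+1%:R :> F by rewrite prodr_const card_ord.
  rewrite -big_split /=.
  apply: eq_bigr => i _.
  transitivity (\sum_j ((n.+1%:R ^+ 2 - 2 * n.+1%:R * k i) *
                        (b j (lift ord0 i))%:R + k i ^+ 2)).
    by apply: eq_bigr => j _; rewrite Ai; case: (b j _) => /=; ring.
  rewrite big_split /= -mulr_sumr sum_ones sumr_const card_ord.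
  by rewrite -[_ *+ n.+1]mulr_natr -/(k i); ring.
have np : 0 < n.+1%:R ^+ n :> F by rewrite exprn_gt0 // ltr0n.
set P := \prod_(i < n) _; set c := n.+1%:R ^+ n in np *; set e := \det _ ^+ 2.
have -> : c ^+ 2 * e = c * (e * c) by ring.
by have -> : n.+1%:R * (c * P) = c * (n.+1%:R * P) by [ring]; rewrite ler_pM2l.
Qed.

Lemma card_cell_hadamard (F : realFieldType) n (b : 'I_n.+1 -> 'I_n.+1 -> bool) :
  (forall j, b j ord0) -> \det (bit_mx F b) != 0 ->
  (#|cell F b|%:R ^+ 2 * n.+1%:R ^+ n : F) <=
  n.+1%:R * \prod_(i < n) ((ones b (lift ord0 i))%:R *
                           (n.+1%:R - (ones b (lift ord0 i))%:R)).
Proof.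
move=> b0 detM; apply: le_trans (bit_mx_hadamard F b0).
rewrite ler_wpM2r ?exprn_ge0 // -[leRHS]real_normK ?num_real //.
by rewrite lerXn2r ?nnegrE // card_cell_le_det.
Qed.

(** A column of zeros, or a second column of ones, would make the matrix singular. *)
Lemma ones_bounds (F : fieldType) n (b : 'I_n.+1 -> 'I_n.+1 -> bool) i :
  (forall j, b j ord0) -> \det (bit_mx F b) != 0 ->
  (0 < ones b (lift ord0 i) < n.+1)%N.
Proof.
move=> b0 detM; apply/andP; split.
  rewrite lt0n; apply: contraNneq detM => /eqP; rewrite cards_eq0 => /eqP k0.
  rewrite -det_tr (expand_det_row _ (lift ord0 i)) big1 // => j _.
  by have := finset.in_set0 j; rewrite -k0 !mxE inE => ->; rewrite mul0r.
rewrite ltn_neqAle -[X in (_ <= X)%N](card_ord n.+1) max_card andbT.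
apply: contraNneq detM => kn.
have b1 j : b j (lift ord0 i).
  have /setP/(_ j) : [set j | b j (lift ord0 i)] = [set: 'I_n.+1].
    by apply/eqP; rewrite eqEcard finset.subsetT cardsT card_ord -/(ones _ _) kn /=.
  by rewrite !inE.
rewrite -det_tr (determinant_alternate (i1 := ord0) (i2 := lift ord0 i)) // => j.
by rewrite !mxE b0 b1.
Qed.

(** * Counting compositions *)

Lemma map_nth_index_enum (T : finType) (V : Type) (x0 : V) (A : {set T}) (s : seq V) :
  size s = #|A| -> [seq nth x0 s (index j (enum A)) | j <- enum A] = s.
Proof.
move=> sz; apply: (@eq_from_nth _ x0); rewrite size_map -cardE ?sz // => i iA.
have [j0 _] : exists j, j \in A by apply/set0Pn; rewrite -card_gt0; lia.
by rewrite (nth_map j0) -?cardE // index_uniq -?cardE ?enum_uniq.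
Qed.

(** Stars and bars on each of the two blocks. Entries never exceed [u] or [v], so the bound [m]
    built into the type excludes no composition. *)
Lemma card_two_block_compositions (T : finType) (J : {set T}) m u v :
  (0 < #|J|)%N -> (0 < #|~: J|)%N -> (u <= m)%N -> (v <= m)%N ->
  #|[set a : {ffun T -> 'I_m.+1} |
      (\sum_(j in J) a j == u)%N && (\sum_(j in ~: J) a j == v)%N]| =
  ('C(#|J|.-1 + u, #|J|.-1) * 'C(#|~: J|.-1 + v, #|~: J|.-1))%N.
Proof.
move=> J0 J'0 um vm; rewrite -!card_ord_partitions -cardsX.
set X1 := [set t | _]; set X0 := [set t | _].
pose g (t : #|J|.-1.+1.-tuple 'I_u.+1 * #|~: J|.-1.+1.-tuple 'I_v.+1) :
    {ffun T -> 'I_m.+1} := [ffun j => inord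
  (if j \in J then nth ord0 t.1 (index j (enum J)) : nat
   else nth ord0 t.2 (index j (enum (~: J))))].
have g1 t j : j \in J -> g t j = nth ord0 t.1 (index j (enum J)) :> nat.
  by move=> jJ; rewrite ffunE jJ inordK // ltnS (leq_trans (leq_ord _) um).
have g0 t j : j \in ~: J -> g t j = nth ord0 t.2 (index j (enum (~: J))) :> nat.
  rewrite inE => /negbTE jJ.
  by rewrite ffunE jJ inordK // ltnS (leq_trans (leq_ord _) vm).
have mg1 t : [seq val (g t j) | j <- enum J] = [seq val x | x <- t.1].
  rewrite -[in RHS](map_nth_index_enum (A := J) ord0 (s := t.1)) ?size_tuple ?prednK //.
  by rewrite -map_comp; apply/eq_in_map => j; rewrite mem_enum => /(g1 t).
have mg0 t : [seq val (g t j) | j <- enum (~: J)] = [seq val x | x <- t.2].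
  rewrite -[in RHS](map_nth_index_enum (A := ~: J) ord0 (s := t.2))
    ?size_tuple ?prednK //.
  by rewrite -map_comp; apply/eq_in_map => j; rewrite mem_enum => /(g0 t).
have sumE (a : T -> nat) (A : {set T}) :
    (\sum_(j in A) a j = \sum_(x <- [seq a j | j <- enum A]) x)%N.
  by rewrite big_map big_enum.
have g_inj : injective g.
  move=> [t1 t0] [s1 s0] ts; congr (_, _); apply/val_inj/(inj_map val_inj).
    by rewrite -(mg1 (t1, t0)) -(mg1 (s1, s0)) ts.
  by rewrite -(mg0 (t1, t0)) -(mg0 (s1, s0)) ts.
rewrite -(card_imset _ g_inj); congr #|pred_of_set _|; apply/setP => a.
apply/idP/imsetP => [|[t]]; last first.
  rewrite !inE => /andP[t1 t0] ->.
  by rewrite !sumE mg1 mg0 !big_map t1 t0.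
rewrite inE => /andP[/eqP a1 /eqP a0].
have le1 j : j \in J -> (a j <= u)%N.
  by move=> jJ; rewrite -a1 (bigD1 j) //= leq_addr.
have le0 j : j \in ~: J -> (a j <= v)%N.
  by move=> jJ; rewrite -a0 (bigD1 j) //= leq_addr.
have sz1 : size [seq inord (a j) : 'I_u.+1 | j <- enum J] == #|J|.-1.+1.
  by rewrite size_map -cardE prednK.
have sz0 : size [seq inord (a j) : 'I_v.+1 | j <- enum (~: J)] == #|~: J|.-1.+1.
  by rewrite size_map -cardE prednK.
exists (Tuple sz1, Tuple sz0).
  rewrite !inE /= !big_map; apply/andP; split; apply/eqP.
    rewrite -[RHS]a1 -big_enum /=.
    by apply: eq_big_seq => j; rewrite mem_enum => /le1 ?; rewrite inordK ?ltnS.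
  rewrite -[RHS]a0 -big_enum /=.
  by apply: eq_big_seq => j; rewrite mem_enum => /le0 ?; rewrite inordK ?ltnS.
apply/ffunP => j; apply/val_inj => /=; have [jJ|jJ] := boolP (j \in J).
  rewrite g1 //= (nth_map j) ?index_mem ?mem_enum // nth_index ?mem_enum //.
  by rewrite inordK // ltnS le1.
have {}jJ : j \in ~: J by rewrite inE.
rewrite g0 //= (nth_map j) ?index_mem ?mem_enum // nth_index ?mem_enum //.
by rewrite inordK // ltnS le0.
Qed.

(** With [bin_fact_leq_exp], this encloses a composition count between pure powers, so that the
    counts become polynomial in [s] and [t]. *)
Lemma exp_leq_bin_fact k u : (u ^ k <= 'C(k + u, k) * k`!)%N.
Proof.
rewrite bin_ffact; elim: k => [|k IHk]; first by rewrite expn0 ffactn0.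
by rewrite expnS addSn ffactSS leq_mul // ltnW // ltnS leq_addl.
Qed.

Lemma bin_fact_leq_exp k u : ('C(k + u, k) * k`! <= (k + u) ^ k)%N.
Proof.
rewrite bin_ffact; move: (k + u)%N => n; elim: k => [|k IHk] //.
by rewrite ffactnSr expnSr leq_mul // leq_subr.
Qed.

(** * Lattice points of the cone over one simplex *)

(** The shift [e] is 0 or 1: with 0 every lattice point of the closed cone is reached, with 1 all
    coefficients are positive and the point lies in the open cone. *)
Definition cone_point d m (b : 'I_d -> 'I_d -> bool) e (r : {ffun 'I_d -> 'I_d})
    (a : {ffun 'I_d -> 'I_m.+1}) (l : 'I_d) : nat :=
  (r l + \sum_j (a j + e) * b j l)%N.

Section ConePoint.
Variables (F : realFieldType) (d : nat) (b : 'I_d -> 'I_d -> bool).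
Hypothesis detM : \det (bit_mx F b) != 0.
Local Notation M := (bit_mx F b).

Lemma bit_mx_unit : M \in unitmx.
Proof. by rewrite unitmxE unitfE. Qed.

Lemma nat_row_cone_point m e r (a : {ffun 'I_d -> 'I_m.+1}) :
  nat_row F (cone_point b e r a) =
  (nat_row F (fun l => r l) *m invmx M + nat_row F (fun j => a j + e)%N) *m M.
Proof.
rewrite mulmxDl mulmxKV ?bit_mx_unit //; apply/rowP => l.
rewrite !mxE natrD; congr (_ + _); rewrite natr_sum; apply: eq_bigr => j _.
by rewrite !mxE natrM.
Qed.

Lemma cell_ge0 r j : r \in cell F b ->
  0 <= (nat_row F (fun l => r l) *m invmx M) 0 j.
Proof. by rewrite inE => /forallP/(_ j)/andP[]. Qed.

(** A cell point is a nonnegative combination of the rows, and the column of ones dominates every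
    other column. *)
Lemma cell_le (r : {ffun 'I_d -> 'I_d}) l l0 :
  (forall j, b j l0) -> r \in cell F b -> (r l <= r l0)%N.
Proof.
move=> b0 rc; rewrite -(ler_nat F).
have rE l' : (r l')%:R =
    \sum_j (nat_row F (fun l => r l) *m invmx M) 0 j * (b j l')%:R.
  have /rowP/(_ l') := mulmxKV bit_mx_unit (nat_row F (fun l => r l)).
  by rewrite !mxE => <-; apply: eq_bigr => j _; rewrite [M j l']mxE.
rewrite !rE; apply: ler_sum => j _; rewrite b0 ler_wpM2l ?cell_ge0 //.
by rewrite ler_nat; case: (b j l).
Qed.

End ConePoint.

(** Cell coefficients lie in [0, 1), so [a] is recovered, up to the shift [e], as the integer parts
    of the coefficients of the point. *)
Lemma cone_point_inj (F : realFieldType) d (b : 'I_d -> 'I_d -> bool) m e r r'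
    (a a' : {ffun 'I_d -> 'I_m.+1}) :
  \det (bit_mx F b) != 0 -> r \in cell F b -> r' \in cell F b ->
  cone_point b e r a =1 cone_point b e r' a' -> (r, a) = (r', a').
Proof.
move=> detM rc rc' eq_pt; have Mu := bit_mx_unit detM.
have aa' : a = a'.
  apply/ffunP => j; apply: val_inj => /=.
  have : nat_row F (cone_point b e r a) = nat_row F (cone_point b e r' a').
    by apply/rowP => l; rewrite !mxE eq_pt.
  rewrite !nat_row_cone_point // => /(can_inj (mulmxK Mu))/rowP/(_ j).
  rewrite [LHS]mxE [RHS]mxE [X in _ + X = _]mxE [X in _ = _ + X]mxE.
  move: rc rc'; rewrite !inE => /forallP/(_ j) + /forallP/(_ j).
  move: (_ 0 j) (_ 0 j) => u v /andP[u0 u1] /andP[v0 v1]; rewrite !natrD => E.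
  have lt1 : (a j)%:R < (a' j + 1)%:R :> F by rewrite natrD; lra.
  have lt2 : (a' j)%:R < (a j + 1)%:R :> F by rewrite natrD; lra.
  by move: lt1 lt2; rewrite !ltr_nat; lia.
congr (_, _) => //; apply/ffunP => l; apply: val_inj => /=.
by have := eq_pt l; rewrite /cone_point aa' => /addIn.
Qed.

(** The integer parts of the coefficients become [a], and their fractional parts give the cell
    point. *)
Lemma cone_point_cover (F : archiRealFieldType) d (b : 'I_d -> 'I_d -> bool) l0 m
    (x : 'I_d -> nat) (c : 'rV[F]_d) :
  \det (bit_mx F b) != 0 -> (forall j, b j l0) -> (x l0 = m)%N ->
  (forall j, 0 <= c 0 j) -> c *m bit_mx F b = nat_row F x ->
  exists r (a : {ffun 'I_d -> 'I_m.+1}),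
    r \in cell F b /\ cone_point b 0 r a =1 x.
Proof.
move=> detM b0 xm c0 cM; have Mu := bit_mx_unit detM.
have xE l : (x l)%:R = \sum_j c 0 j * (b j l)%:R.
  have /rowP/(_ l) := cM; rewrite !mxE => <-.
  by apply: eq_bigr => j _; rewrite [bit_mx _ _ _ _]mxE.
pose fl j := Num.truncn (c 0 j).
have flP j : (fl j)%:R <= c 0 j < (fl j).+1%:R by exact: truncn_itv.
(* The column of ones makes [m] the sum of the coefficients. *)
have fl_le j : (fl j <= m)%N.
  have /andP[fl_c _] := flP j; rewrite -(ler_nat F) -xm xE (le_trans fl_c) //.
  by rewrite (bigD1 j) //= b0 mulr1 lerDl sumr_ge0 // => k _; rewrite b0 mulr1.
pose a : {ffun 'I_d -> 'I_m.+1} := [ffun j => inord (fl j)].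
have aE j : a j = fl j :> nat by rewrite ffunE inordK // ltnS.
pose y l := (\sum_j fl j * b j l)%N.
have xyE l : (x l)%:R - (y l)%:R = \sum_j (c 0 j - (fl j)%:R) * (b j l)%:R :> F.
  rewrite xE /y natr_sum -sumrB; apply: eq_bigr => j _.
  by rewrite natrM mulrBl.
have y_le l : (y l <= x l)%N.
  rewrite -(ler_nat F) -subr_ge0 xyE sumr_ge0 // => j _.
  by rewrite mulr_ge0 // subr_ge0; have /andP[] := flP j.
have xy_lt l : (x l - y l < d)%N.
  rewrite -(ltr_nat F) natrB // xyE -[X in X%:R](card_ord d) -sum1_card natr_sum.
  apply: ltr_sum => [|j _].
    by rewrite has_predT /index_enum -enumT size_enum_ord; case: (d) l => // -[].
  have /andP[f0 f1] := flP j; rewrite -natr1 in f1.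
  by case: (b j l); rewrite ?mulr1 ?mulr0 //; lra.
pose r : {ffun 'I_d -> 'I_d} := [ffun l => Ordinal (xy_lt l)].
exists r, a; split; last first.
  move=> l; rewrite /cone_point ffunE /= -[RHS](subnK (y_le l)); congr addn.
  by apply: eq_bigr => j _; rewrite aE addn0.
have rE : nat_row F (fun l => r l) = (c - nat_row F fl) *m bit_mx F b.
  apply/rowP => l; rewrite !mxE ffunE /= natrB // xyE.
  by apply: eq_bigr => j _; rewrite !mxE.
rewrite inE rE mulmxK //; apply/forallP => j.
by rewrite !mxE; have := flP j; rewrite -natr1; lra.
Qed.

(** * Slices of a cone at a fixed height and coordinate *)

Section Slice.
Variables (F : realFieldType) (n : nat) (b : 'I_n.+1 -> 'I_n.+1 -> bool).
Hypothesis b0 : forall j, b j ord0.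
Hypothesis detM : \det (bit_mx F b) != 0.
Variables (i : 'I_n) (s t : nat).
Local Notation li := (lift ord0 i).
Local Notation k := (ones b li).
Local Notation J := [set j | b j li].

(** The two equations decouple: they prescribe separately the sum of [a] over the rows with a one in
    column [li] and the sum over the other rows. *)
Definition slice e (r : {ffun 'I_n.+1 -> 'I_n.+1}) :
    {set {ffun 'I_n.+1 -> 'I_(s + t).+1}} :=
  [set a | (cone_point b e r a ord0 == s + t)%N && (cone_point b e r a li == s)].

Lemma cone_point_lift e r (a : {ffun 'I_n.+1 -> 'I_(s + t).+1}) :
  cone_point b e r a li = (r li + (\sum_(j in J) a j + e * k))%N.
Proof.
congr addn; transitivity (\sum_(j in J) (a j + e))%N.
  rewrite [RHS]big_mkcond; apply: eq_bigr => j _; rewrite inE.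
  by case: (b j li); rewrite ?muln1 ?muln0.
by rewrite big_split /= sum_nat_const mulnC.
Qed.

Lemma card_setC_ones : #|~: J| = (n.+1 - k)%N.
Proof. by rewrite cardsCs finset.setCK card_ord. Qed.

Lemma cone_point_ord0 e r (a : {ffun 'I_n.+1 -> 'I_(s + t).+1}) :
  cone_point b e r a ord0 =
  (r ord0 + (\sum_(j in J) a j + e * k +
             (\sum_(j in ~: J) a j + e * (n.+1 - k))))%N.
Proof.
congr addn; transitivity (\sum_j (a j + e))%N.
  by apply: eq_bigr => j _; rewrite b0 muln1.
rewrite (bigID (mem J)) /= [X in (_ + X)%N](eq_bigl (mem (~: J))) => [|j];
  last by rewrite !inE.
by rewrite !big_split /= !sum_nat_const -card_setC_ones !(mulnC _ e).
Qed.

Lemma card_slice_le (r : {ffun 'I_n.+1 -> 'I_n.+1}) : r \in cell F b ->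
  (#|slice 0 r| <= 'C(k.-1 + s, k.-1) * 'C(n - k + t, n - k))%N.
Proof.
move=> rc; have /andP[k0 kn] := ones_bounds i b0 detM.
have r_le := cell_le detM li b0 rc.
pose u := (s - r li)%N; pose v := (t - (r ord0 - r li))%N.
apply: (@leq_trans #|[set a : {ffun 'I_n.+1 -> 'I_(s + t).+1} |
      (\sum_(j in J) a j == u)%N && (\sum_(j in ~: J) a j == v)%N]|).
  apply/subset_leq_card/fintype.subsetP => a; rewrite !inE.
  rewrite cone_point_ord0 cone_point_lift !mul0n !addn0.
  move: (\sum_(j in J) a j)%N (\sum_(j in ~: J) a j)%N => x y /andP[/eqP e1 /eqP e2].
  by apply/andP; split; apply/eqP; rewrite /u /v; lia.
have J'E := card_setC_ones.
rewrite card_two_block_compositions -?/k ?J'E ?subn_gt0 //; try lia.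
rewrite -/(ones b li) subSn // [_.+1.-1]/= leq_mul // leq_bin2l //; lia.
Qed.

(** In each block, [n.+1.*2] pays for the cell point, which takes at most n, and for the shift by 1
    of at most n coefficients. *)
Lemma card_slice_ge (r : {ffun 'I_n.+1 -> 'I_n.+1}) :
  r \in cell F b -> (n.+1.*2 <= s)%N -> (n.+1.*2 <= t)%N ->
  ('C(k.-1 + (s - n.+1.*2), k.-1) * 'C(n - k + (t - n.+1.*2), n - k) <=
   #|slice 1 r|)%N.
Proof.
move=> rc sn tn; have /andP[k0 kn] := ones_bounds i b0 detM.
have r_le := cell_le detM li b0 rc.
have r_lt := ltn_ord (r ord0).
pose u := (s - r li - k)%N; pose v := (t - (r ord0 - r li) - (n.+1 - k))%N.
apply: (@leq_trans #|[set a : {ffun 'I_n.+1 -> 'I_(s + t).+1} |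
      (\sum_(j in J) a j == u)%N && (\sum_(j in ~: J) a j == v)%N]|); last first.
  apply/subset_leq_card/fintype.subsetP => a; rewrite !inE.
  rewrite cone_point_ord0 cone_point_lift !mul1n => /andP[/eqP-> /eqP->].
  apply/andP; split; apply/eqP.
    by rewrite /u /v; lia.
  by rewrite /u; lia.
have J'E := card_setC_ones.
rewrite card_two_block_compositions -?/k ?J'E ?subn_gt0 //; try lia.
rewrite -/(ones b li) subSn // [_.+1.-1]/= leq_mul // leq_bin2l //; lia.
Qed.

End Slice.

(* A dissection seen through the cones over its simplices in dimension n + 1: *)
(* the rows of [bit_mx F (B q)] are the vertices of the simplex [q] preceded  *)
(* by a coordinate equal to 1.                                                *)
Record lattice_dissection (F : realFieldType) n N
    (B : 'I_N -> 'I_n.+1 -> 'I_n.+1 -> bool) : Prop := LatticeDissection {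
  ld_height : forall q j, B q j ord0;
  ld_det : forall q, \det (bit_mx F (B q)) != 0;
  ld_cover : forall x : 'I_n.+1 -> nat,
    (0 < x ord0)%N -> (forall l, x l <= x ord0)%N ->
    exists q, exists2 c : 'rV[F]_n.+1, forall j, 0 <= c 0 j &
      c *m bit_mx F (B q) = nat_row F x;
  ld_disjoint : forall q q' (c c' : 'rV[F]_n.+1),
    (forall j, 0 < c 0 j) -> (forall j, 0 < c' 0 j) ->
    c *m bit_mx F (B q) = c' *m bit_mx F (B q') -> q = q'
}.

(** * Counting the lattice points of the cone over the cube *)

Definition grid n m (i : 'I_n) s : {set {ffun 'I_n.+1 -> 'I_m.+1}} :=
  [set x : {ffun 'I_n.+1 -> 'I_m.+1} |
    (x ord0 == m :> nat) && (x (lift ord0 i) == s :> nat)].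

Lemma card_grid n m (i : 'I_n) s : (s <= m)%N -> #|grid m i s| = (m.+1 ^ n.-1)%N.
Proof.
move=> sm.
pose P (l : 'I_n.+1) : pred 'I_m.+1 := fun y =>
  if l == ord0 then y == m :> nat else if l == lift ord0 i then y == s :> nat else true.
have Pm v : (v <= m)%N -> #|[pred y : 'I_m.+1 | y == v :> nat]| = 1%N.
  move=> vm; rewrite -(card1 (inord v : 'I_m.+1)); apply: eq_card => y.
  by rewrite !inE -val_eqE /= inordK.
have -> : #|grid m i s| = #|(family P : simpl_pred {ffun 'I_n.+1 -> 'I_m.+1})|.
  apply: eq_card => x; rewrite inE; apply/andP/familyP => [[x0 xi] l|xP].
    by rewrite /P /in_mem /=; case: eqP => [->//|_]; case: eqP => [->//|].
  by split; [have := xP ord0 | have := xP (lift ord0 i)]; rewrite /P /in_mem /= ?eqxx.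
rewrite card_familyE big_ord_recl (Pm m) // mul1n (bigD1 i) //=.
rewrite [X in (X * _)%N](_ : _ = 1%N); last first.
  rewrite -(Pm s sm); apply: eq_card => y; rewrite !inE /P.
  by rewrite /in_mem /= eqxx.
rewrite mul1n (eq_bigr (fun=> m.+1)) => [|l li]; last first.
  rewrite -[RHS]card_ord; apply: eq_card => y.
  by rewrite /P /in_mem /= (inj_eq (@lift_inj _ ord0)) (negbTE li).
by rewrite prod_nat_const cardC1 card_ord.
Qed.

Section Sandwich.
Variables (F : archiRealFieldType) (n N : nat).
Variable B : 'I_N -> 'I_n.+1 -> 'I_n.+1 -> bool.
Hypothesis BD : lattice_dissection F B.
Variables (i : 'I_n) (s t : nat).
Local Notation k q := (ones (B q) (lift ord0 i)).

Definition decompositions e :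
    {set 'I_N * {ffun 'I_n.+1 -> 'I_n.+1} * {ffun 'I_n.+1 -> 'I_(s + t).+1}} :=
  [set p | (p.1.2 \in cell F (B p.1.1)) && (p.2 \in slice (B p.1.1) i s t e p.1.2)].

Lemma card_decompositions e :
  #|decompositions e| = (\sum_q \sum_(r in cell F (B q)) #|slice (B q) i s t e r|)%N.
Proof.
rewrite -sum1dep_card.
rewrite -(pair_big_dep (fun p : 'I_N * {ffun 'I_n.+1 -> 'I_n.+1} =>
    p.2 \in cell F (B p.1)) (fun p a => a \in slice (B p.1) i s t e p.2)
    (fun _ _ => 1%N)) /=.
rewrite -(pair_big_dep xpredT (fun q r => r \in cell F (B q))
    (fun q r => \sum_(a in slice (B q) i s t e r) 1)%N) /=.
by apply: eq_bigr => q _; apply: eq_bigr => r _; rewrite sum1_card.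
Qed.

Definition decomposition_point e
    (p : 'I_N * {ffun 'I_n.+1 -> 'I_n.+1} * {ffun 'I_n.+1 -> 'I_(s + t).+1}) :
    {ffun 'I_n.+1 -> 'I_(s + t).+1} :=
  [ffun l => inord (cone_point (B p.1.1) e p.1.2 p.2 l)].

Lemma decomposition_pointE e p l : p \in decompositions e ->
  decomposition_point e p l = cone_point (B p.1.1) e p.1.2 p.2 l :> nat.
Proof.
rewrite inE => /andP[rc]; rewrite inE => /andP[/eqP hm _].
rewrite ffunE inordK // ltnS -[X in (_ <= X)%N]hm leq_add //.
  exact: (cell_le (ld_det BD _) _ (ld_height BD _) rc).
by apply: leq_sum => j _; rewrite (ld_height BD) leq_mul // leq_b1.
Qed.

Lemma grid_sub_decompositions : (0 < s + t)%N ->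
  grid (s + t) i s \subset [set decomposition_point 0 p | p in decompositions 0].
Proof.
move=> st0; apply/fintype.subsetP => x; rewrite inE => /andP[/eqP x0 /eqP xi].
have [q [c c0 cM]] : exists q, exists2 c : 'rV[F]_n.+1, forall j, 0 <= c 0 j &
    c *m bit_mx F (B q) = nat_row F (fun l => x l).
  by apply: (ld_cover BD) => [|l]; rewrite x0 // -ltnS.
have [r [a [rc raE]]] := cone_point_cover (ld_det BD q) (ld_height BD q) x0 c0 cM.
have pD : (q, r, a) \in decompositions 0.
  by rewrite inE /= rc inE !raE x0 xi !eqxx.
apply/imsetP; exists (q, r, a) => //.
by apply/ffunP => l; apply: val_inj; rewrite /= decomposition_pointE //= raE.
Qed.

Lemma decomposition_point_in_grid p : p \in decompositions 1 ->
  decomposition_point 1 p \in grid (s + t) i s.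
Proof.
move=> pD; rewrite inE !decomposition_pointE //.
by move: pD; rewrite inE => /andP[_]; rewrite inE.
Qed.

(** With shift 1 the point is interior to its cone, so disjointness determines the simplex, and
    [cone_point_inj] the rest. *)
Lemma decomposition_point_inj :
  {in decompositions 1 &, injective (decomposition_point 1)}.
Proof.
move=> [[q r] a] [[q' r'] a'] pD pD' pp'.
have eq_pt l : cone_point (B q) 1 r a l = cone_point (B q') 1 r' a' l.
  have /= <- := decomposition_pointE l pD; have /= <- := decomposition_pointE l pD'.
  by rewrite pp'.
have rc : r \in cell F (B q) by move: pD; rewrite inE => /andP[].
have rc' : r' \in cell F (B q') by move: pD'; rewrite inE => /andP[].
have posE (q1 : 'I_N) (r1 : {ffun 'I_n.+1 -> 'I_n.+1})
    (a1 : {ffun 'I_n.+1 -> 'I_(s + t).+1}) j : r1 \in cell F (B q1) ->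
    0 < (nat_row F (fun l => r1 l) *m invmx (bit_mx F (B q1)) +
         nat_row F (fun j => a1 j + 1)%N) 0 j.
  move=> r1c; rewrite mxE ltr_wpDl ?(cell_ge0 _ r1c) // mxE ltr0n; lia.
have qq' : q = q'.
  apply: (ld_disjoint BD (fun j => posE q r a j rc) (fun j => posE q' r' a' j rc')).
  rewrite -!nat_row_cone_point ?(ld_det BD) //.
  by apply/rowP => l; rewrite !mxE eq_pt.
move: eq_pt rc'; rewrite -qq' => eq_pt rc'.
by have [-> ->] := cone_point_inj (ld_det BD q) rc rc' eq_pt.
Qed.

Lemma grid_upper : (0 < s + t)%N ->
  ((s + t).+1 ^ n.-1 <= \sum_q #|cell F (B q)| *
     ('C((k q).-1 + s, (k q).-1) * 'C(n - k q + t, n - k q)))%N.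
Proof.
move=> st0; rewrite -(card_grid i (leq_addr t s)).
apply: leq_trans (subset_leq_card (grid_sub_decompositions st0)) _.
apply: leq_trans (leq_imset_card _ _) _; rewrite card_decompositions.
apply: leq_sum => q _; rewrite -sum_nat_const; apply: leq_sum => r rc.
by apply: card_slice_le rc; [exact: ld_height BD q | exact: ld_det BD q].
Qed.

Lemma grid_lower : (n.+1.*2 <= s)%N -> (n.+1.*2 <= t)%N ->
  (\sum_q #|cell F (B q)| * ('C((k q).-1 + (s - n.+1.*2), (k q).-1) *
     'C(n - k q + (t - n.+1.*2), n - k q)) <= (s + t).+1 ^ n.-1)%N.
Proof.
move=> sn tn; rewrite -(card_grid i (leq_addr t s)).
apply: (@leq_trans #|decompositions 1|).
  rewrite card_decompositions; apply: leq_sum => q _.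
  rewrite -sum_nat_const; apply: leq_sum => r rc.
  by apply: card_slice_ge rc sn tn; [exact: ld_height BD q | exact: ld_det BD q].
rewrite -(card_in_imset decomposition_point_inj); apply/subset_leq_card/fintype.subsetP.
by move=> _ /imsetP[p pD ->]; exact: decomposition_point_in_grid.
Qed.

End Sandwich.

(** * From asymptotic counts to a polynomial identity *)

(** An algebraic passage to the limit: on [0, 1] the value at x exceeds [P.[0]] by at most x times
    the sum of the absolute coefficients, which is too little at x = 1/m if [P.[0] < 0] and m is
    large. *)
Lemma poly_ge0_of_inv_nat (F : archiRealFieldType) (P : {poly F}) m0 :
  (forall m, (m0 <= m)%N -> (0 < m)%N -> 0 <= P.[m%:R^-1]) -> 0 <= P.[0].
Proof.
move=> P_ge0; rewrite leNgt; apply/negP => P0.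
pose K : F := \sum_(j < size P) `|P`_j|.
have K0 : 0 <= K by apply: sumr_ge0.
have bound (x : F) : 0 <= x <= 1 -> P.[x] <= P.[0] + x * K.
  move=> /andP[x0 x1]; rewrite horner_coef0 /K.
  have [->|/polySpred sP] := eqVneq P 0.
    by rewrite size_poly0 !big_ord0 horner0 coef0; lra.
  rewrite horner_coef sP !big_ord_recl /= expr0 mulr1 lerD2l mulrDr mulr_sumr.
  rewrite ler_wpDl ?mulr_ge0 //; apply: ler_sum => j _ /=.
  rewrite exprS mulrCA ler_wpM2l // (le_trans (ler_norm _)) // normrM.
  by rewrite ler_piMr // ger0_norm ?exprn_ge0 // exprn_ile1.
pose m := maxn m0 (Num.bound (K / - P.[0])).+1.
have m0' : 0 < m%:R :> F by rewrite ltr0n /m; lia.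
have Km : K < m%:R * - P.[0].
  rewrite -ltr_pdivrMr ?oppr_gt0 //.
  apply: lt_le_trans (archi_boundP _) _; first by rewrite divr_ge0 // oppr_ge0 ltW.
  by rewrite ler_nat (leq_trans (leqnSn _) (leq_maxr _ _)).
have m1 : 0 <= (m%:R^-1 : F) <= 1.
  by rewrite invr_ge0 ltW //= invf_le1 // ler1n /m; lia.
have := P_ge0 m (leq_maxl _ _); rewrite -(ltr0n F) m0' => /(_ isT).
apply/negP; rewrite -ltNge; apply: le_lt_trans (bound _ m1) _.
by rewrite -ltrBrDl sub0r mulrC ltr_pdivrMr // mulrC.
Qed.

Lemma poly_eq_nat (F : numFieldType) (P Q : {poly F}) :
  (forall p : nat, (0 < p)%N -> P.[p%:R] = Q.[p%:R]) -> P = Q.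
Proof.
move=> PQ; apply/eqP; rewrite -subr_eq0; apply/negP => /negP PQ0.
have := max_poly_roots (rs := [seq p.+1%:R | p <- iota 0 (size (P - Q))]) PQ0.
rewrite size_map size_iota ltnn => H; suff: false by []; apply: H.
  by apply/allP => _ /mapP[p _ ->]; rewrite /root !hornerE PQ // subrr.
rewrite map_inj_uniq ?iota_uniq // => p p' /eqP.
by rewrite eqr_nat => /eqP[].
Qed.

Section OnesDistribution.
Variables (F : archiRealFieldType) (n N : nat).
Variable B : 'I_N -> 'I_n.+1 -> 'I_n.+1 -> bool.
Hypothesis BD : lattice_dissection F B.
Variable i : 'I_n.
Local Notation k q := (ones (B q) (lift ord0 i)).

(** The coefficient of the leading term s^(k - 1) t^(n - k) in the count of points contributed by
    [q]. *)
Let w q : F := #|cell F (B q)|%:R / ((k q).-1`!%:R * (n - k q)`!%:R).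

Let w_ge0 q : 0 <= w q. Proof. by rewrite divr_ge0 ?mulr_ge0. Qed.

Let kP q : (0 < k q < n.+1)%N.
Proof. exact: ones_bounds (ld_height BD q) (ld_det BD q). Qed.

Lemma bin_weight q u v :
  (#|cell F (B q)| * ('C((k q).-1 + u, (k q).-1) * 'C(n - k q + v, n - k q)))%:R =
  w q * (('C((k q).-1 + u, (k q).-1) * (k q).-1`!)%:R *
         ('C(n - k q + v, n - k q) * (n - k q)`!)%:R).
Proof.
rewrite /w !natrM; have := fact_gt0 (k q).-1; have := fact_gt0 (n - k q)%N.
by rewrite -!(ltr0n F) => /gt_eqF/negbT f1 /gt_eqF/negbT f2; field; rewrite f1.
Qed.

Lemma weight_upper s t : (0 < s + t)%N ->
  (s + t).+1%:R ^+ n.-1 <=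
  \sum_q w q * ((s%:R + n%:R) ^+ (k q).-1 * (t%:R + n%:R) ^+ (n - k q)).
Proof.
move=> st; rewrite -natrX.
have exp_mono x y e : (x <= y -> x ^ e <= y ^ e)%N.
  by case: e => // e xy; rewrite leq_exp2r.
have := grid_upper BD i st; rewrite -(ler_nat F) => /le_trans; apply.
rewrite natr_sum; apply: ler_sum => q _; rewrite bin_weight ler_wpM2l //.
have kn := kP q; rewrite -!natrD -!natrX -!natrM ler_nat leq_mul //.
  by apply: leq_trans (bin_fact_leq_exp _ _) _; apply: exp_mono; lia.
by apply: leq_trans (bin_fact_leq_exp _ _) _; apply: exp_mono; lia.
Qed.

Lemma weight_lower s t : (n.+1.*2 <= s)%N -> (n.+1.*2 <= t)%N ->
  \sum_q w q * ((s%:R - n.+1.*2%:R) ^+ (k q).-1 * (t%:R - n.+1.*2%:R) ^+ (n - k q)) <=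
  (s + t).+1%:R ^+ n.-1.
Proof.
move=> sn tn; rewrite -natrX.
have := grid_lower BD i sn tn; rewrite -(ler_nat F); apply: le_trans.
rewrite natr_sum; apply: ler_sum => q _; rewrite bin_weight ler_wpM2l //.
by rewrite -!natrB // -!natrX -!natrM ler_nat leq_mul // exp_leq_bin_fact.
Qed.

(** Put s = p m and t = m in the two weight bounds, divide by m^(n - 1) and let m grow: the constant
    shifts disappear. *)
Lemma weight_eq (p : nat) : (0 < p)%N ->
  \sum_q w q * p%:R ^+ (k q).-1 = (p%:R + 1) ^+ n.-1.
Proof.
move=> p0.
(* The exponents (k - 1) and (n - k) add up to n - 1 for every simplex, so the same power of m
   factors out of each term. *)
have scale (x y z : F) m q : m != 0 ->
    w q * ((p%:R * m + x * z) ^+ (k q).-1 * (m + y * z) ^+ (n - k q)) =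
    m ^+ n.-1 * (w q * ((p%:R + x * (z / m)) ^+ (k q).-1 *
                        (1 + y * (z / m)) ^+ (n - k q))).
  move=> m_neq0; have kn := kP q.
  have -> : n.-1 = ((k q).-1 + (n - k q))%N by lia.
  have -> : p%:R * m + x * z = m * (p%:R + x * (z / m)) by field.
  have -> : m + y * z = m * (1 + y * (z / m)) by field.
  by rewrite exprD !exprMn; ring.
have scale1 (m : nat) : (0 < m)%N ->
    (p * m + m).+1%:R ^+ n.-1 = m%:R ^+ n.-1 * (p%:R + 1 + m%:R^-1) ^+ n.-1 :> F.
  rewrite -(ltr0n F) => m0; rewrite -exprMn -natr1 natrD natrM; congr (_ ^+ _).
  by field; rewrite gt_eqF.
apply/eqP; rewrite eq_le; apply/andP; split; rewrite -subr_ge0.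
  (* The rescaled inequality as a polynomial in 1/m; its value at 0 is the difference sought. *)
  pose P : {poly F} := (p%:R%:P + 1 + 'X) ^+ n.-1 - \sum_q w q *:
    ((p%:R%:P - n.+1.*2%:R *: 'X) ^+ (k q).-1 * (1 - n.+1.*2%:R *: 'X) ^+ (n - k q)).
  have PE x : P.[x] = (p%:R + 1 + x) ^+ n.-1 - \sum_q w q *
      ((p%:R - n.+1.*2%:R * x) ^+ (k q).-1 * (1 - n.+1.*2%:R * x) ^+ (n - k q)).
    rewrite /P !hornerE horner_sum; congr (_ - _); apply: eq_bigr => q _.
    by rewrite !hornerE.
  have := @poly_ge0_of_inv_nat F P n.+1.*2; rewrite PE !mulr0 addr0.
  under eq_bigr do rewrite !subr0 expr1n mulr1.
  apply=> m mn m0; rewrite PE subr_ge0.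
  have m0' : 0 < m%:R :> F by rewrite ltr0n.
  have pm : (n.+1.*2 <= p * m)%N by apply: leq_trans mn _; exact: leq_pmull.
  have := weight_lower pm mn; rewrite scale1 //.
  under eq_bigr => q _.
    rewrite natrM -[n.+1.*2%:R]mulr1 -!mulNr scale ?gt_eqF // !mul1r !mulNr.
  over.
  by rewrite -mulr_sumr ler_pM2l // exprn_gt0.
pose P : {poly F} := \sum_q w q *:
    ((p%:R%:P + n%:R *: 'X) ^+ (k q).-1 * (1 + n%:R *: 'X) ^+ (n - k q))
  - (p%:R%:P + 1 + 'X) ^+ n.-1.
have PE x : P.[x] = \sum_q w q *
    ((p%:R + n%:R * x) ^+ (k q).-1 * (1 + n%:R * x) ^+ (n - k q)) -
    (p%:R + 1 + x) ^+ n.-1.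
  rewrite /P !hornerE horner_sum; congr (_ - _); apply: eq_bigr => q _.
  by rewrite !hornerE.
have := @poly_ge0_of_inv_nat F P 0; rewrite PE !mulr0 !addr0.
under eq_bigr do rewrite expr1n mulr1.
apply=> m _ m0; rewrite PE subr_ge0.
have m0' : 0 < m%:R :> F by rewrite ltr0n.
have pm : (0 < p * m + m)%N by lia.
have := weight_upper pm; rewrite scale1 //.
under eq_bigr => q _.
  rewrite natrM -[n%:R in X in w q * X]mulr1 scale ?gt_eqF // !mul1r.
over.
by rewrite -mulr_sumr ler_pM2l // exprn_gt0.
Qed.

(** The coefficient of degree [kk.-1] in [weight_eq] is the binomial C(n - 1, kk - 1), and the
    factorials in [w] turn it into (n - 1)!, whatever [kk] is. *)
Lemma sum_card_cell_ones kk : (0 < kk <= n)%N ->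
  (\sum_(q | k q == kk) #|cell F (B q)| = n.-1`!)%N.
Proof.
move=> /andP[kk0 kkn].
have PQ : \sum_q w q *: 'X^((k q).-1) = ('X + 1) ^+ n.-1 :> {poly F}.
  apply: poly_eq_nat => p p0; rewrite horner_sum !hornerE -(weight_eq p0).
  by apply: eq_bigr => q _; rewrite !hornerE.
have := congr1 (fun P : {poly F} => P`_kk.-1) PQ.
rewrite exprD1n !coef_sum (bigD1 (inord kk.-1)) //=.
rewrite [X in _ = _ + X]big1 => [|j jk].
  rewrite coefMn coefXn inordK ?eqxx ?addr0; last by lia.
  move=> E; apply/eqP; rewrite -(eqr_nat F) natr_sum.
  have ff : (kk.-1`! * (n - kk)`!)%:R != 0 :> F.
    by rewrite pnatr_eq0 -lt0n muln_gt0 !fact_gt0.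
  have <- : ('C(n.-1, kk.-1) * (kk.-1`! * (n - kk)`!) = n.-1`!)%N.
    by have -> : (n - kk = n.-1 - kk.-1)%N by [lia]; rewrite bin_fact //; lia.
  rewrite natrM -E mulr_suml big_mkcond /=; apply/eqP; apply: eq_bigr => q _.
  rewrite coefZ coefXn; have kq := kP q; case: (eqVneq (k q) kk) => [kq_eq|kkq].
    by rewrite /w kq_eq eqxx mulr1 -natrM divfK.
  by rewrite (_ : (_ == _) = false) ?mulr0 ?mul0r //; apply/negbTE; lia.
rewrite coefMn coefXn (_ : (_ == _) = false) ?mul0rn //.
apply/negbTE; apply: contra jk => /eqP e; apply/eqP/val_inj; rewrite /= e.
by rewrite inordK // ltn_ord.
Qed.

End OnesDistribution.

(** * Equidistribution and the AM-GM bound *)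

Lemma sum_cell_ones (R : realType) n N (B : 'I_N -> 'I_n.+2 -> 'I_n.+2 -> bool)
    (i : 'I_n.+1) (f : nat -> R) :
  lattice_dissection R B ->
  \sum_q #|cell R (B q)|%:R * f (ones (B q) (lift ord0 i)) =
  n`!%:R * \sum_(j < n.+1) f j.+1.
Proof.
move=> BD; have kP q := ones_bounds i (ld_height BD q) (ld_det BD q).
rewrite (partition_big
  (fun q => inord (ones (B q) (lift ord0 i)).-1 : 'I_n.+1) xpredT) //=.
rewrite mulr_sumr; apply: eq_bigr => j _.
have jn : (0 < j.+1 <= n.+1)%N by rewrite ltn_ord.
rewrite -[n]/(n.+1.-1) -(sum_card_cell_ones BD i jn) natr_sum mulr_suml.
have kE q : (inord (ones (B q) (lift ord0 i)).-1 == j) =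
            (ones (B q) (lift ord0 i) == j.+1).
  have /andP[k0 kn] := kP q; rewrite -val_eqE /= inordK; last by lia.
  by apply/eqP/eqP; lia.
by apply: eq_big => // q; rewrite kE => /eqP->.
Qed.

Lemma sum_ln_fact (R : realType) n : \sum_(j < n) ln (j.+1%:R : R) = ln (n`!%:R).
Proof.
elim: n => [|n IHn]; first by rewrite big_ord0 fact0 ln1.
by rewrite big_ord_recr /= IHn factS mulnC natrM lnM // posrE ltr0n ?fact_gt0.
Qed.

(* AM-GM over the simplices weighted by their volumes, in the form            *)
(* 1 + x <= exp x: as every count of ones is equidistributed over 1, ..., n,  *)
(* the geometric mean of the Hadamard bounds is exactly (n!)^2.               *)
Lemma lattice_dissection_card (R : realType) n N
    (B : 'I_N -> 'I_n.+1 -> 'I_n.+1 -> bool) :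
  (0 < n)%N -> lattice_dissection R B ->
  (n%:R + 1 : R) `^ ((n%:R - 1) / 2) <= N%:R.
Proof.
case: n B => // n B _ BD; set h := _ `^ _.
pose D q : R := #|cell R (B q)|%:R.
pose k q i := ones (B q) (lift ord0 i).
pose g j : R := j%:R * (n.+2%:R - j%:R).
pose y q := \prod_(i < n.+1) g (k q i).
have g_gt0 q i : 0 < g (k q i).
  have /andP[k0 kn] := ones_bounds i (ld_height BD q) (ld_det BD q).
  by rewrite mulr_gt0 ?ltr0n // subr_gt0 ltr_nat.
have y_gt0 q : 0 < y q by apply: prodr_gt0.
have ln_y q : ln (y q) = \sum_(i < n.+1) ln (g (k q i)).
  suff [] : 0 < y q /\ ln (y q) = \sum_(i < n.+1) ln (g (k q i)) by [].
  rewrite /y; elim/big_rec2: _ => [|i x z _ [z0 <-]]; first by rewrite ln1.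
  by split; [exact: mulr_gt0 | rewrite lnM ?posrE].
pose L := ln (n.+1`!%:R : R).
have sumD : \sum_q D q = n.+1`!%:R.
  have := sum_cell_ones ord0 (fun=> 1) BD; rewrite sumr_const card_ord.
  under eq_bigr do rewrite mulr1.
  by move=> ->; rewrite factS natrM mulrC.
(* The factors j and n + 2 - j both run over 1, ..., n + 1, and [rev_ord] exchanges them. *)
have sum_ln_g : \sum_(j < n.+1) ln (g j.+1) = 2%:R * L.
  rewrite (eq_bigr (fun j : 'I_n.+1 => ln (j.+1%:R : R) + ln ((rev_ord j).+1%:R : R))).
    rewrite big_split /= /L -(sum_ln_fact R n.+1) mulr_natl mulr2n; congr (_ + _).
    by rewrite [RHS](reindex_inj rev_ord_inj).
  move=> j _; rewrite -lnM ?posrE ?ltr0n // /g -natrB ?ltnS; last exact: ltnW.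
  by rewrite /= subSn.
have sumDy : \sum_q D q * ln (y q) = n.+1`!%:R * (2 * L).
  under eq_bigr do rewrite ln_y mulr_sumr.
  rewrite exchange_big /=.
  under eq_bigr do rewrite (sum_cell_ones _ (fun j => ln (g j)) BD) sum_ln_g.
  by rewrite sumr_const card_ord factS natrM -mulr_natl; ring.
have h_ge0 : 0 <= h by exact: powR_ge0.
have h2 : h ^+ 2 = n.+2%:R ^+ n.
  rewrite -powR_mulrn // /h natr1 -powRrM -powR_mulrn //.
  by congr (_ `^ _); rewrite -natr1; field.
(* The square root of the Hadamard bound, after cancelling one factor n + 2. *)
have hD q : h * D q <= expR (ln (y q) / 2).
  rewrite -(@ler_pXn2r _ 2) ?nnegrE ?expR_ge0 ?mulr_ge0 //.
  rewrite -expRM_natl mulrCA divff // mulr1 lnK ?posrE // exprMn h2.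
  have := card_cell_hadamard (ld_height BD q) (ld_det BD q).
  by rewrite [n.+2%:R ^+ n.+1]exprS mulrCA ler_pM2l ?ltr0n // mulrC.
(* By [hD] each simplex contributes at most 1 to [h] times this sum. *)
suff one_le : 1 <= \sum_q D q * expR (- (ln (y q) / 2)).
  apply: le_trans (_ : h * \sum_q D q * expR (- (ln (y q) / 2)) <= _).
    by rewrite ler_peMr.
  have -> : N%:R = \sum_(q < N) 1 :> R by rewrite sumr_const card_ord.
  rewrite mulr_sumr; apply: ler_sum => q _.
  by rewrite mulrA expRN ler_pdivrMr ?expR_gt0 // mul1r.
have n0 : 0 < n.+1`!%:R :> R by rewrite ltr0n fact_gt0.
have eL : expR L = n.+1`!%:R by rewrite lnK // posrE.
(* Multiplying by (n + 1)! = exp L centres the exponents: the weighted sum of [L - ln (y q) / 2] is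
   0, so the linear bound on exp loses nothing on average. *)
rewrite -(ler_pM2l n0) mulr1 mulr_sumr -eL.
apply: le_trans (_ : \sum_q D q * (1 + (L - ln (y q) / 2)) <= _); last first.
  apply: ler_sum => q _; rewrite mulrCA -expRD ler_wpM2l //.
  exact: expR_ge1Dx.
rewrite eL; under eq_bigr do rewrite mulrDr mulr1 mulrBr mulrA.
by rewrite big_split /= sumrB -!mulr_suml sumD sumDy; lra.
Qed.

(** * From a geometric dissection to its lattice data *)

(** A coordinate strictly between 0 and 1 could be moved by [d] either way inside the cube, making
    [x] the midpoint of two distinct points. *)
Lemma cube_vertex_coord (R : realType) n (x : 'rV[R]_n) l :
  vertices (@cube R n) x -> x 0 l = (x 0 l == 1)%:R.
Proof.
move=> [Cx x_ext]; have /andP[x0 x1] := Cx l.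
have [->//|xn1] := eqVneq (x 0 l) 1; apply/eqP; rewrite /= -[_ == _]negbK.
apply/negP => xn0; pose d := Num.min (x 0 l) (1 - x 0 l).
have d0 : 0 < d by rewrite lt_min subr_gt0 !lt_neqAle eq_sym xn0 xn1 x0 x1.
have [dx dx1] : d <= x 0 l /\ d <= 1 - x 0 l by rewrite !ge_min !lexx orbT.
pose y e := x + (e * d) *: delta_mx 0 l : 'rV[R]_n.
have yE e j : y e 0 j = x 0 j + e * d * (j == l)%:R by rewrite !mxE.
have Cy e : `|e| <= 1 -> cube (y e).
  move=> e1 j; rewrite yE; have := Cx j; case: eqVneq => [->|_]; last first.
    by rewrite mulr0 addr0.
  rewrite ler_norml in e1; have /andP[e1' e1''] := e1.
  have : - d <= e * d <= d by rewrite -mulN1r ler_pM2r // e1' ger_pMl.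
  by rewrite mulr1; lra.
have : y 1 = y (-1).
  apply: (x_ext _ _ 2^-1); first by apply: Cy; rewrite normr1.
  - by apply: Cy; rewrite normrN1.
  - by apply/andP; split; lra.
  - by apply/rowP => j; rewrite mxE [X in _ = X + _]mxE [X in _ = _ + X]mxE !yE; field.
move=> /rowP/(_ l); rewrite !yE eqxx !mulr1 mul1r mulN1r => /addrI; lra.
Qed.

Definition homogenize (R : realType) n (x : 'rV[R]_n) : 'rV[R]_n.+1 :=
  \row_l oapp (x 0) 1 (unlift ord0 l).

Definition vertex_bits (R : realType) n (v : 'I_n.+1 -> 'rV[R]_n)
    (j l : 'I_n.+1) : bool :=
  oapp (fun l' => v j 0 l' == 1) true (unlift ord0 l).

Section VertexBits.
Variables (R : realType) (n : nat) (v : 'I_n.+1 -> 'rV[R]_n).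
Hypothesis v_bits : forall j l, v j 0 l = (v j 0 l == 1)%:R.
Hypothesis v_free : affinely_independent v.
Local Notation M := (bit_mx R (vertex_bits v)).

Lemma mul_vertex_bits0 (c : 'rV[R]_n.+1) : (c *m M) 0 ord0 = \sum_j c 0 j.
Proof.
rewrite mxE; apply: eq_bigr => j _.
by rewrite mxE /vertex_bits unlift_none mulr1.
Qed.

Lemma mul_vertex_bits_lift (c : 'rV[R]_n.+1) l :
  (c *m M) 0 (lift ord0 l) = (\sum_j c 0 j *: v j) 0 l.
Proof.
rewrite mxE summxE; apply: eq_bigr => j _.
by rewrite !mxE /vertex_bits liftK /= [in RHS]v_bits.
Qed.

Lemma mul_vertex_bits_homogenize (c : 'rV[R]_n.+1) x :
  c *m M = homogenize x <-> \sum_j c 0 j = 1 /\ \sum_j c 0 j *: v j = x.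
Proof.
split=> [cM|[c1 cx]].
  split; first by rewrite -mul_vertex_bits0 cM mxE unlift_none.
  by apply/rowP => l; rewrite -mul_vertex_bits_lift cM mxE liftK.
apply/rowP => l; rewrite [RHS]mxE; case: unliftP => [l'|] -> /=.
  by rewrite mul_vertex_bits_lift cx.
by rewrite mul_vertex_bits0 c1.
Qed.

(** Affine independence of points is linear independence of their homogenizations. *)
Lemma vertex_bits_det : \det M != 0.
Proof.
apply/negP => /det0P[c c_neq0 cM]; move: c_neq0; apply/negP; rewrite negbK.
apply/eqP/rowP => j; rewrite mxE; apply: (v_free (w := c 0)).
  by rewrite -mul_vertex_bits0 cM mxE.
by apply/rowP => l; rewrite -mul_vertex_bits_lift cM !mxE.
Qed.

(** Barycentric coordinates are linear in the homogenized point, so a small move keeps them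
    nonnegative. *)
Lemma interior_convex_hull (c : 'rV[R]_n.+1) :
  (forall j, 0 < c 0 j) -> \sum_j c 0 j = 1 ->
  interior (convex_hull v) (\sum_j c 0 j *: v j).
Proof.
move=> c_gt0 c1; set x := \sum_j _.
have Mu : M \in unitmx by rewrite unitmxE unitfE vertex_bits_det.
have cE : c = homogenize x *m invmx M.
  by apply: (canRL (mulmxK Mu)); apply/mul_vertex_bits_homogenize.
pose K : R := 1 + \sum_j \sum_l `|invmx M l j|.
have K0 : 0 < K by rewrite ltr_pwDl // sumr_ge0 // => j _; exact: sumr_ge0.
(* A positive lower bound for all [c 0 j]; within radius [e / K] no barycentric coordinate changes
   by more than [e]. *)
pose e : R := (\sum_j (c 0 j)^-1)^-1.
have inv_le j : (c 0 j)^-1 <= \sum_j (c 0 j)^-1.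
  by rewrite (bigD1 j) //= lerDl sumr_ge0 // => j' _; rewrite invr_ge0 ltW.
have e0 : 0 < e by rewrite invr_gt0 (lt_le_trans _ (inv_le ord0)) // invr_gt0.
have e_le j : e <= c 0 j.
  rewrite -[leRHS]invrK lef_pV2 ?posrE ?invr_gt0 //.
  by rewrite (lt_le_trans _ (inv_le j)) ?invr_gt0.
apply/nbhs_ballP; exists (e / K) => /=; first exact: divr_gt0.
move=> z xz; have {}xz l : `|x 0 l - z 0 l| <= e / K.
  by apply/ltW; case: xz => _ /(_ 0 l).
exists ((homogenize z *m invmx M) 0).
have [z1 zE] : \sum_j (homogenize z *m invmx M) 0 j = 1 /\
    \sum_j (homogenize z *m invmx M) 0 j *: v j = z.
  by apply/mul_vertex_bits_homogenize; rewrite mulmxKV.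
split=> // j; rewrite -subr_le0 sub0r.
have dE : c 0 j - (homogenize z *m invmx M) 0 j =
    \sum_l (homogenize x 0 l - homogenize z 0 l) * invmx M l j.
  by rewrite cE !mxE -sumrB; apply: eq_bigr => l _; rewrite mulrBl.
have : c 0 j - (homogenize z *m invmx M) 0 j <= e.
  rewrite dE (le_trans (ler_norm _)) // (le_trans (ler_norm_sum _ _ _)) //.
  apply: (@le_trans _ _ (\sum_l e / K * `|invmx M l j|)).
    apply: ler_sum => l _; rewrite normrM ler_wpM2r // !mxE.
    by case: unliftP => [l'|] _ /=; rewrite ?subrr ?normr0 ?xz // divr_ge0 ?ltW.
  rewrite -mulr_sumr mulrAC ler_pdivrMr // ler_wpM2l ?(ltW e0) // /K.
  rewrite [X in 1 + X](bigD1 j) //=.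
  by rewrite addrCA lerDl addr_ge0 // sumr_ge0 // => j' _; exact: sumr_ge0.
by have := e_le j; lra.
Qed.

End VertexBits.

(** Dividing by the height turns cones back into simplices: covering is read off the cube at height
    1, and a point common to two open cones becomes a common interior point of two simplices. *)
Lemma dissection_lattice (R : realType) n N (S : 'I_N -> 'I_n.+1 -> 'rV[R]_n) :
  is_dissection (@cube R n) S -> lattice_dissection R (fun q => vertex_bits (S q)).
Proof.
move=> [Sv Sfree Scover Sdisj].
have Sbits q j l : S q j 0 l = (S q j 0 l == 1)%:R.
  by exact: cube_vertex_coord (Sv q j).
split.
- by move=> q j; rewrite /vertex_bits unlift_none.
- by move=> q; exact: vertex_bits_det (Sbits q) (Sfree q).
- move=> x x0 x_le; set m : R := (x ord0)%:R.
  have m0 : 0 < m by rewrite ltr0n.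
  have : cube (\row_l ((x (lift ord0 l))%:R / m) : 'rV[R]_n).
    by move=> l; rewrite mxE divr_ge0 ?(ltW m0) //= ler_pdivrMr // mul1r ler_nat.
  rewrite Scover => -[q _ [w [w0 w1 xE]]]; exists q.
  pose c : 'rV[R]_n.+1 := \row_j w j.
  exists (m *: c) => [j|]; first by rewrite !mxE mulr_ge0 // ltW.
  have /(mul_vertex_bits_homogenize (Sbits q)) cM : \sum_j c 0 j = 1 /\
      \sum_j c 0 j *: S q j = \row_l ((x (lift ord0 l))%:R / m).
    split; first by rewrite -w1; apply: eq_bigr => j _; rewrite mxE.
    by rewrite xE; apply: eq_bigr => j _; rewrite mxE.
  rewrite -scalemxAl cM; apply/rowP => l; rewrite !mxE.
  by case: unliftP => [l'|] -> /=; rewrite ?mulr1 // mxE mulrC divfK ?gt_eqF.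
- move=> q q' c c' c0 c0' cM; apply/eqP/negP => /negP qq'.
  pose h := \sum_j c 0 j.
  have hE : h = \sum_j c' 0 j.
    by rewrite -(mul_vertex_bits0 (S q')) -cM mul_vertex_bits0.
  have h0 : 0 < h.
    by rewrite /h (bigD1 ord0) //= ltr_pwDl // sumr_ge0 // => j _; rewrite ltW.
  have scale_gt0 (a : 'rV[R]_n.+1) : (forall j, 0 < a 0 j) ->
      forall j, 0 < (h^-1 *: a) 0 j.
    by move=> a0 j; rewrite mxE mulr_gt0 // invr_gt0.
  have scale_sum (a : 'rV[R]_n.+1) : h = \sum_j a 0 j -> \sum_j (h^-1 *: a) 0 j = 1.
    move=> ha; under eq_bigr do rewrite mxE.
    by rewrite -mulr_sumr -ha mulVf // gt_eqF.
  have I := interior_convex_hull (Sbits q) (Sfree q)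
    (scale_gt0 c c0) (scale_sum c erefl).
  have I' := interior_convex_hull (Sbits q') (Sfree q')
    (scale_gt0 c' c0') (scale_sum c' hE).
  have pE : \sum_j (h^-1 *: c) 0 j *: S q j = \sum_j (h^-1 *: c') 0 j *: S q' j.
    apply/rowP => l; rewrite -!(mul_vertex_bits_lift (Sbits _)).
    by rewrite -!scalemxAl cM.
  have := Sdisj q q' qq'; rewrite -subset0; apply; split; [exact: I|].
  by rewrite pE.
Qed.

Theorem theorem3 (R : realType) (n : nat) (n_gt0 : (0 < n)%N) :
  (n%:R + 1 : R) `^ ((n%:R - 1) / 2) <= (dis R n)%:R.
Proof.
rewrite /dis; case: ex_minnP => N /asboolP[S SD] _.
exact: lattice_dissection_card n_gt0 (dissection_lattice SD).
Qed.
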